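(* Let $k$ be a positive integer, $F=\{1,2,\dots,k\}$ and $\mathfrak{p}_F(x)=\prod_{j\in F}(x-j)$. Let $a\neq 0$ be a real number such that $c_k^{-a}(-n)\neq 0$ for all $n\ge 1$, where $c_k^{-a}$ is the Charlier polynomial with parameter $-a$. Then the orthogonal polynomials $(q_n)_{n\ge 0}$ with respect to the measure $$\mathfrak{p}_F\,\rho_a=\sum_{x=0}^\infty\mathfrak{p}_F(x)\frac{a^x}{x!}\,\delta_x$$ are common eigenfunctions of a difference operator of order $2k+2$ and genre $(-k-1,k+1)$; that is, there are such an operator $D$ and numbers $\lambda_n$ with $D(q_n)=\lambda_nq_n$ for all $n\ge 0$.
   Context: For $l\in\mathbb{Z}$ the shift operator $\mathfrak{s}_l$ acts on polynomials by $\mathfrak{s}_l(f)(x)=f(x+l)$. A finite difference operator $\sum_{l=s}^r f_l\,\mathfrak{s}_l$ (with polynomial coefficients $f_l$ independent of $n$) with $f_s,f_r\neq 0$ has order $r-s$ and genre $(s,r)$. Charlier polynomials (for any real $a\neq 0$): $c_n^a(x)=\frac{1}{n!}\sum_{j=0}^n(-a)^{n-j}\binom{n}{j}\binom{x}{j}j!$. Charlier measure: $\rho_a=\sum_{x=0}^\infty\frac{a^x}{x!}\delta_x$, where $\delta_x$ is the Dirac mass at $x$. Measures may be signed. Orthogonal polynomials with respect to a (signed) measure $\mu$ are polynomials $(q_n)_n$ with $\deg q_n=n$, $\int q_nx^m\,d\mu=0$ for $0\le m<n$ and $\int q_nx^n\,d\mu\neq 0$ (each $q_n$ is unique up to a nonzero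 constant factor). *)

(* Defs.v *)
From mathcomp Require Import all_boot all_order all_algebra.
From mathcomp Require Import all_classical all_reals all_analysis.
Set Implicit Arguments.
Unset Strict Implicit.
Unset Printing Implicit Defensive.
Import Order.TTheory GRing.Theory Num.Theory.
Import numFieldNormedType.Exports.
Local Open Scope classical_set_scope.
Local Open Scope ring_scope.

Definition poly_shift (R : realType) (l : int) (p : {poly R}) : {poly R} :=
  p \Po ('X + (l%:~R)%:P).

(* The coefficients of a difference operator acting on polynomials are
   determined by the operator, so genre and order are well defined on the
   underlying map. *)
Definition diffop_genre (R : realType) (D : {poly R} -> {poly R}) (s r : int) :
    Prop :=
  s <= r /\
  exists f : int -> {poly R}, [/\ f s != 0, f r != 0 &
    forall p, D p =
      \sum_(0 <= i < (`|r - s|%N).+1) f (s + i%:Z) * poly_shift (s + i%:Z) p].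

Definition diffop_order (R : realType) (D : {poly R} -> {poly R}) (m : nat) :
    Prop :=
  exists s r : int, diffop_genre D s r /\ r - s = m%:Z.

(* binom(x, j) as a polynomial in x *)
Definition binomial_poly (R : realType) (j : nat) : {poly R} :=
  (j`!%:R)^-1 *: \prod_(i < j) ('X - (i%:R)%:P).

Definition charlier (R : realType) (a : R) (n : nat) : {poly R} :=
  (n`!%:R)^-1 *:
    \sum_(j < n.+1) ((- a) ^+ (n - j) * 'C(n, j)%:R * j`!%:R) *:
      binomial_poly R j.

Definition pF (R : realType) (F : seq nat) : {poly R} :=
  \prod_(j <- F) ('X - (j%:R)%:P).

(* A signed measure on the real line, presented as the difference of two
   positive measures (possibly infinite, so [spos - sneg] is only meaningful
   where it is not oo - oo). *)
Record signed_measure (R : realType) := SignedMeasure {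
  spos : {measure set (measurableTypeR R) -> \bar R} ;
  sneg : {measure set (measurableTypeR R) -> \bar R} }.

Definition sintegrable (R : realType) (mu : signed_measure R) (f : R -> R) :
    Prop :=
  (spos mu).-integrable setT (EFin \o f) /\
  (sneg mu).-integrable setT (EFin \o f).

Definition sintegral (R : realType) (mu : signed_measure R) (f : R -> R) : R :=
  Rintegral (spos mu) setT f - Rintegral (sneg mu) setT f.

Definition atomic_measure (R : realType) (w : nat -> {nonneg R}) :
    {measure set (measurableTypeR R) -> \bar R} :=
  mseries (fun x => mscale (w x) (dirac (x%:R : measurableTypeR R))) 0.

(* sum_x w(x) delta_x for real weights w *)
Definition signed_atomic (R : realType) (w : nat -> R) : signed_measure R :=
  SignedMeasure
    (atomic_measure (fun x => NngNum (funrpos_ge0 w x)))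
    (atomic_measure (fun x => NngNum (funrneg_ge0 w x))).

Definition pF_charlier_measure (R : realType) (F : seq nat) (a : R) :
    signed_measure R :=
  signed_atomic (fun x => (pF R F).[x%:R] * (a ^+ x / x`!%:R)).

Definition orthogonal_polynomials (R : realType) (mu : signed_measure R)
    (q : nat -> {poly R}) : Prop :=
  [/\ forall p : {poly R}, sintegrable mu (fun x => p.[x]),
      forall n, size (q n) = n.+1,
      forall n m, (m < n)%N -> sintegral mu (fun x => (q n).[x] * x ^+ m) = 0 &
      forall n, sintegral mu (fun x => (q n).[x] * x ^+ n) <> 0].

(* Main.v *)
From HB Require Import structures.
Require Import Defs.
From mathcomp Require Import all_boot all_order all_algebra.
From mathcomp Require Import all_classical all_reals all_analysis.
From mathcomp Require Import measurable_realfun ring lra zify.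
Set Implicit Arguments.
Unset Strict Implicit.
Unset Printing Implicit Defensive.
Import Order.TTheory GRing.Theory Num.Theory.
Import numFieldNormedType.Exports.
Local Open Scope classical_set_scope.
Local Open Scope ring_scope.

(** Since [x * pF(x) = x (x - 1) ... (x - k)], the modified measure multiplied
    by [x] is, up to the factor [a ^+ k.+1], the translate of the Charlier
    measure by [k.+1].
    Hence if [P n] is the Charlier polynomial [c_n^a(x - k - 1)], any
    combination of [P n] and [P n.-1] is orthogonal to [x, ..., x ^ (n - 1)] for
    the modified measure, and the orthogonal polynomial is the combination
    whose integral is zero. The integral of [P n] is
    [expR a * k! * (-1) ^ n * Y(n)] with [Y(n) = c_k^{-a}(- n - 1)]
    ([charlier_fun_dual]), so the orthogonal polynomials are
    [Q n = Y(n - 1) P n + Y(n) P (n - 1)] ([krall_charlier]). The hypothesis on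
    [a] says that no [Y(n)] with [n >= 0] vanishes, and [Y(- 1) = a ^ k / k!]; this
    gives both the degree of [Q n] and the nonvanishing of its pairing with
    [x ^ n].

    For the difference operator, let [L] be the Charlier operator with
    [L (P n) = - (n + 1) P n] ([charlier_op_eigen]), and consider a polynomial
    [u] in [L]. As [P n + P (n - 1) = s_1 (P n)], where [s_l] denotes the shift
    by [l], the operator [c_k^{-a}(L)] maps [Q n] to [Y(n - 1) Y(n) s_1 (P n)].
    Therefore [D = s_{-1} c_k^{-a}(L) + u(L)] maps [Q n] to
    [[Y(n - 1) Y(n) + Y(n - 1) u(- n - 1)] P n + Y(n) u(- n) P (n - 1)], and this
    is [u(- n) Q n] as soon as [u(- n) - u(- n - 1) = Y(n)]. The choice
    [u = c_{k+1}^{-a}] satisfies this, because the forward difference lowers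
    the index of the Charlier polynomials by one. The genre of [D] is found by
    following the two extreme coefficients of the powers of [L]
    ([krall_charlier_op_genre]); the statement for every orthogonal family
    follows from uniqueness up to a factor ([orthogonal_unique]). *)

(** * Integration against signed atomic measures *)

Section AtomicIntegral.
Variable R : realType.
Implicit Types (w : nat -> {nonneg R}) (f : R -> R).

Lemma integral_atomic_ge0 w f : measurable_fun setT (f : measurableTypeR R -> R) ->
    (forall x, 0 <= f x) ->
    cvgn (series (fun n => (w n)%:num * f n%:R)) ->
  (\int[atomic_measure w]_x (f x)%:E =
    (limn (series (fun n => (w n)%:num * f n%:R)%R))%:E)%E.
Proof.
move=> mf f0 cf.
rewrite ge0_integral_measure_series//; last 2 first.
- by move=> t _; rewrite lee_fin.
- exact/measurable_EFinP.
transitivity (\sum_(0 <= n <oo) ((w n)%:num * f n%:R)%:E)%E.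
  apply: eq_eseriesr => n _.
  rewrite ge0_integral_mscale//; last 2 first.
  - exact/measurable_EFinP.
  - by move=> t _; rewrite lee_fin.
  rewrite integral_dirac//; last exact/measurable_EFinP.
  by rewrite diracT mul1e EFinM.
rewrite -EFin_lim//.
by congr (limn _); apply/funext => n /=; rewrite sumEFin.
Qed.

Lemma integral_atomic w f : measurable_fun setT (f : measurableTypeR R -> R) ->
    cvgn (series (fun n => (w n)%:num * `|f n%:R|)) ->
  (atomic_measure w).-integrable setT (EFin \o f) /\
  \int[atomic_measure w]_x f x = limn (series (fun n => (w n)%:num * f n%:R)).
Proof.
move=> mf cf.
have c_le (g : R -> R) : (forall x, 0 <= g x <= `|f x|) ->
    cvgn (series (fun n => (w n)%:num * g n%:R)).
  move=> gf; apply: series_le_cvg cf => n; last first.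
  - by apply: ler_wpM2l => //; case/andP: (gf n%:R).
  - by rewrite mulr_ge0.
  - by rewrite mulr_ge0//; case/andP: (gf n%:R).
split.
  apply/integrableP; split; first exact/measurable_EFinP.
  rewrite (_ : (fun x => _) = EFin \o (Num.norm \o f)); last exact/funext.
  rewrite integral_atomic_ge0//; first by rewrite ltry.
    exact: measurableT_comp.
  by move=> x /=.
have cp : cvgn (series (fun n => (w n)%:num * f^\+ n%:R)).
  by apply: c_le => x; rewrite funrpos_ge0/= /funrpos ge_max ler_norm/=.
have cn : cvgn (series (fun n => (w n)%:num * f^\- n%:R)).
  by apply: c_le => x; rewrite funrneg_ge0/= /funrneg ge_max -normrN ler_norm/=.
rewrite /Rintegral integralE.
rewrite -/(EFin \o f) funerpos funerneg.
rewrite !integral_atomic_ge0//; last 2 first.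
- exact: measurable_funrneg.
- exact: measurable_funrpos.
rewrite -EFinB/= -lim_seriesB//; congr (limn (series _)).
apply/funext => n; rewrite /= !fctE -mulrBr; congr (_ * _).
by rewrite -{3}(funrposBneg f).
Qed.

(** Absolute convergence keeps both the positive and the negative part of the
    signed measure finite, so that their difference is the sum of the series. *)
Lemma signed_atomic_integral (w : nat -> R) f :
    measurable_fun setT (f : measurableTypeR R -> R) ->
    cvgn [normed series (fun n => w n * f n%:R)] ->
  sintegrable (signed_atomic w) f /\
  Defs.sintegral (signed_atomic w) f = limn (series (fun n => w n * f n%:R)).
Proof.
move=> mf cwf.
have c_le (v : nat -> R) : (forall x, 0 <= v x <= `|w x|) ->
    cvgn (series (fun n => v n * `|f n%:R|)).
  move=> vw; apply: series_le_cvg cwf => n /=.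
  - by rewrite mulr_ge0//; case/andP: (vw n).
  - by [].
  - by rewrite normrM ler_wpM2r//; case/andP: (vw n).
have cp : cvgn (series (fun n => w^\+ n * `|f n%:R|)).
  by apply: c_le => x; rewrite funrpos_ge0/= /funrpos ge_max ler_norm/=.
have cn : cvgn (series (fun n => w^\- n * `|f n%:R|)).
  by apply: c_le => x; rewrite funrneg_ge0/= /funrneg ge_max -normrN ler_norm/=.
have [ip ep] := integral_atomic (w := fun x => NngNum (funrpos_ge0 w x)) mf cp.
have [im em] := integral_atomic (w := fun x => NngNum (funrneg_ge0 w x)) mf cn.
split; first by split.
have normed_cvgM (v : nat -> R) : (forall x, 0 <= v x) ->
    cvgn (series (fun n => v n * `|f n%:R|)) ->
  cvgn (series (fun n => v n * f n%:R)).
  move=> v0 cv; apply: normed_cvg.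
  rewrite [X in cvgn X](_ : _ = series (fun n => v n * `|f n%:R|))//.
  by congr (series _); apply/funext => n; rewrite /= normrM ger0_norm.
rewrite /Defs.sintegral /= ep em -lim_seriesB/=; last 2 first.
- by apply: normed_cvgM => // x; exact: funrpos_ge0.
- by apply: normed_cvgM => // x; exact: funrneg_ge0.
congr (limn (series _)); apply/funext => n; rewrite /= !fctE -mulrBl.
by congr (_ * _); rewrite -{3}(funrposBneg w).
Qed.

End AtomicIntegral.

(** * The Charlier functional *)

Section CharlierFunctional.
Variable R : realType.
Implicit Types (a : R) (p f g : {poly R}).

(** Integration of polynomials against the Charlier measure. *)
Definition charlier_fun a p : R :=
  limn (series (fun x => p.[x%:R] * (a ^+ x / x`!%:R))).

(** An exponential bound at the integers is all that the convergence of
    [charlier_fun] requires, since [a ^+ x / x`!] absorbs any [B ^+ x]. *)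
Lemma horner_nat_le p :
  exists K B : R, [/\ 0 <= K, 1 <= B & forall x, `|p.[x%:R]| <= K * B ^+ x].
Proof.
elim/poly_ind: p => [|p c [K [B [K0 B1 pK]]]].
  exists 0, 1; split => // x; first by rewrite horner0 normr0 mul0r.
exists (K + `|c|), (2 * B); split => [||x]; first exact: addr_ge0.
- by lra.
rewrite !hornerE (le_trans (ler_normD _ _))// mulrDl lerD//.
- rewrite normrM mulrC exprMn mulrCA ler_pM// normr_nat.
  by rewrite -natrX ler_nat ltnW// ltn_expl.
- by rewrite ler_peMr// exprn_ege1//; lra.
Qed.

Lemma is_cvg_charlier a p :
  cvgn [normed series (fun x => p.[x%:R] * (a ^+ x / x`!%:R))].
Proof.
have [K [B [K0 B1 pK]]] := horner_nat_le p.
have : cvgn (series (K *: exp_coeff (B * `|a|))).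
  exact/is_cvg_seriesZ/is_cvg_series_exp_coeff.
have B0 : 0 <= B by lra.
apply: series_le_cvg => n /=.
- by [].
- by rewrite mulr_ge0// exp_coeff_ge0// mulr_ge0.
rewrite normrM normf_div normrX normr_nat.
rewrite [leRHS](_ : _ = K * B ^+ n * (`|a| ^+ n / n`!%:R)); last first.
  by rewrite -mulrA [B ^+ n * _]mulrA -exprMn.
by rewrite ler_wpM2r// divr_ge0// exprn_ge0.
Qed.

Lemma charlier_funD a p q :
  charlier_fun a (p + q) = charlier_fun a p + charlier_fun a q.
Proof.
rewrite /charlier_fun -lim_seriesD; try exact/normed_cvg/is_cvg_charlier.
congr (limn (series _)); apply/funext => n /=.
by rewrite hornerD mulrDl.
Qed.

Lemma charlier_funZ a c p : charlier_fun a (c *: p) = c * charlier_fun a p.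
Proof.
rewrite -[RHS]/(c *: _) /charlier_fun -lim_seriesZ; last first.
  exact/normed_cvg/is_cvg_charlier.
by congr (limn (series _)); apply/funext => n /=; rewrite hornerZ -mulrA.
Qed.

Lemma charlier_fun1 a : charlier_fun a 1 = expR a.
Proof.
by congr (limn (series _)); apply/funext => n /=; rewrite hornerC mul1r.
Qed.

(** The discrete Pearson equation of the weight, [x * (a ^+ x / x`!)] at
    [x.+1] being [a] times the weight at [x]: the index of summation slides by
    one and the term at [0] is killed by the factor ['X]. Together with
    linearity and the value at [1], this relation determines the functional. *)
Lemma charlier_funXM a p :
  charlier_fun a ('X * p) = a * charlier_fun a (poly_shift 1 p).
Proof.
set u := fun x => ('X * p).[x%:R] * (a ^+ x / x`!%:R).
have cu : cvgn (series u) by exact/normed_cvg/is_cvg_charlier.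
have -> : charlier_fun a ('X * p) = limn (fun n => series u n.+1).
  rewrite /charlier_fun -/u; apply/esym/cvg_lim => //.
  by have := cu; rewrite -(cvg_shiftS (series u)).
rewrite -charlier_funZ; congr (limn _); apply/funext => n.
rewrite /series/= big_nat_recl//= /u hornerM hornerX !mul0r add0r.
apply: eq_bigr => i _; rewrite !hornerE horner_comp !hornerE.
rewrite exprS factS natrM -natr1 /=.
have i0 : (i`!%:R : R) != 0 by rewrite pnatr_eq0 -lt0n fact_gt0.
have i1 : (i%:R + 1 : R) != 0 by rewrite natr1 pnatr_eq0.
by field; apply/andP.
Qed.

End CharlierFunctional.

(** * Shifts of polynomials *)

Section PolyShift.
Variable R : realType.
Implicit Types (l m : int) (p q f : {poly R}).

Lemma poly_shiftD l p q : poly_shift l (p + q) = poly_shift l p + poly_shift l q.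
Proof. exact: comp_polyD. Qed.

Lemma poly_shiftB l p q : poly_shift l (p - q) = poly_shift l p - poly_shift l q.
Proof. exact: comp_polyB. Qed.

Lemma poly_shiftZ l (c : R) p : poly_shift l (c *: p) = c *: poly_shift l p.
Proof. exact: comp_polyZ. Qed.

Lemma poly_shiftM l p q : poly_shift l (p * q) = poly_shift l p * poly_shift l q.
Proof. exact: comp_polyM. Qed.

Lemma poly_shiftC l (c : R) : poly_shift l c%:P = c%:P.
Proof. exact: comp_polyC. Qed.

Lemma poly_shiftX l : poly_shift l ('X : {poly R}) = 'X + (l%:~R)%:P.
Proof. exact: comp_polyX. Qed.

Lemma poly_shift_sum l n (F : 'I_n -> {poly R}) :
  poly_shift l (\sum_(i < n) F i) = \sum_(i < n) poly_shift l (F i).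
Proof. by rewrite /poly_shift raddf_sum. Qed.

Lemma poly_shift0 p : poly_shift 0 p = p.
Proof. by rewrite /poly_shift addr0 comp_polyXr. Qed.

Lemma poly_shift_shift l m p :
  poly_shift l (poly_shift m p) = poly_shift (l + m) p.
Proof.
rewrite /poly_shift -comp_polyA comp_polyD comp_polyX comp_polyC.
by rewrite -addrA -polyCD intrD.
Qed.

Lemma poly_shiftK p : poly_shift 1 (poly_shift (-1) p) = p.
Proof. by rewrite poly_shift_shift subrr poly_shift0. Qed.

Lemma poly_shiftNK p : poly_shift (-1) (poly_shift 1 p) = p.
Proof. by rewrite poly_shift_shift addNr poly_shift0. Qed.

Lemma size_poly_shift l p : size (poly_shift l p) = size p.
Proof. by rewrite size_comp_poly2// size_XaddC. Qed.

Lemma horner_poly_shift l p x : (poly_shift l p).[x] = p.[x + l%:~R].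
Proof. by rewrite horner_comp !hornerE. Qed.

Lemma size_poly_diff p : (size (poly_shift 1 p - p)%R <= (size p).-1)%N.
Proof.
elim/poly_ind: p => [|p c IH].
  by rewrite /poly_shift linear0 subr0 size_poly0.
rewrite poly_shiftD poly_shiftM poly_shiftX !poly_shiftC.
have -> : poly_shift 1 p * ('X + 1%:P) + c%:P - (p * 'X + c%:P) =
  (poly_shift 1 p - p) * 'X + poly_shift 1 p by rewrite polyC1; ring.
have [->|p0] := eqVneq p 0.
  by rewrite /poly_shift linear0 subr0 mul0r !add0r size_poly0.
rewrite [in leqRHS]size_MXaddC (negbTE p0)/= (leq_trans (size_polyD _ _))//.
rewrite size_poly_shift geq_max leqnn andbT.
have p_gt0 : (0 < size p)%N by rewrite size_poly_gt0.
have [->|d0] := eqVneq (poly_shift 1 p - p) 0; first by rewrite mul0r size_poly0.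
by rewrite size_mulX//; apply: leq_ltn_trans IH _; rewrite prednK.
Qed.

Lemma size_sub_lead p q : p != 0 -> size q = size p ->
  (size (q - (lead_coef q / lead_coef p) *: p)%R < size p)%N.
Proof.
move=> p0 qp; have lp : lead_coef p != 0 by rewrite lead_coef_eq0.
have p_gt0 : (0 < size p)%N by rewrite size_poly_gt0.
rewrite -(prednK p_gt0) ltnS; apply/leq_sizeP => i; rewrite leq_eqVlt.
rewrite coefB coefZ => /predU1P[<-|lt_i].
  by rewrite -lead_coefE -{1}qp -lead_coefE divfK// subrr.
have : (size p <= i)%N by rewrite -(prednK p_gt0).
by move=> le_i; rewrite !nth_default ?qp// mulr0 subrr.
Qed.

End PolyShift.

(** * Charlier polynomials *)

Section CharlierPolynomials.
Variable R : realType.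
Implicit Types (a : R) (p q f : {poly R}).

Definition falling j : {poly R} := \prod_(i < j) ('X - (i%:R)%:P).

Lemma fallingSr j : falling j.+1 = falling j * ('X - (j%:R)%:P).
Proof. by rewrite /falling big_ord_recr. Qed.

Lemma fallingS j : falling j.+1 = 'X * poly_shift (-1) (falling j).
Proof.
rewrite /falling big_ord_recl/= subr0; congr (_ * _).
rewrite /poly_shift rmorph_prod; apply: eq_bigr => i _.
rewrite -[RHS]/(poly_shift (-1) ('X - (i%:R)%:P)) poly_shiftB poly_shiftX poly_shiftC.
by rewrite /bump/= natrD polyCD mulrN1z polyCN opprD addrA.
Qed.

Lemma falling_diff j :
  poly_shift 1 (falling j.+1) - falling j.+1 = j.+1%:R *: falling j.
Proof.
rewrite {1}fallingS fallingSr poly_shiftM poly_shiftK poly_shiftX.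
by rewrite -mul_polyC polyC1 -natr1 polyCD polyC1; ring.
Qed.

Lemma binomial_polyS j :
  j.+1%:R *: binomial_poly R j.+1 = 'X * poly_shift (-1) (binomial_poly R j).
Proof.
rewrite /binomial_poly -!/(falling _) fallingS poly_shiftZ scalerA -scalerAr.
by congr (_ *: _); rewrite factS natrM invfM mulrA divff ?mul1r// pnatr_eq0.
Qed.

Lemma binomial_poly_diff j :
  poly_shift 1 (binomial_poly R j.+1) - binomial_poly R j.+1 = binomial_poly R j.
Proof.
rewrite /binomial_poly -!/(falling _) poly_shiftZ -scalerBr falling_diff scalerA.
by congr (_ *: _); rewrite factS natrM invfM mulrC mulrA divff ?mul1r// pnatr_eq0.
Qed.

Lemma binomial_poly0 : binomial_poly R 0 = 1.
Proof. by rewrite /binomial_poly big_ord0 fact0 invr1 scale1r. Qed.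

Lemma size_falling j : size (falling j) = j.+1.
Proof.
elim: j => [|j IH]; first by rewrite /falling big_ord0 size_poly1.
by rewrite fallingSr size_Mmonic ?monicXsubC -?size_poly_gt0 ?IH// size_XsubC addn2.
Qed.

Lemma size_binomial_poly j : size (binomial_poly R j) = j.+1.
Proof.
by rewrite size_scale ?size_falling// invr_eq0 pnatr_eq0 -lt0n fact_gt0.
Qed.

(** The form of the Charlier polynomials as a convolution of the sequences
    [(- a) ^+ i / i`!] and [binomial_poly R j], from which the lowering and
    raising relations are read off term by term. *)
Lemma charlierE a n : charlier a n =
  \sum_(j < n.+1) ((- a) ^+ (n - j) / (n - j)`!%:R) *: binomial_poly R j.
Proof.
rewrite /charlier scaler_sumr; apply: eq_bigr => -[j /=]; rewrite ltnS => jn _.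
rewrite scalerA; congr (_ *: _).
have nz i : (i`!%:R : R) != 0 by rewrite pnatr_eq0 -lt0n fact_gt0.
rewrite -(bin_fact jn) !natrM.
have b0 : ('C(n, j)%:R : R) != 0 by rewrite pnatr_eq0 -lt0n bin_gt0.
by field; rewrite b0 !nz.
Qed.

Lemma charlier0 a : charlier a 0 = 1.
Proof. by rewrite charlierE big_ord1 subnn expr0 fact0 divr1 scale1r binomial_poly0. Qed.

Lemma charlier_diff a n :
  poly_shift 1 (charlier a n.+1) - charlier a n.+1 = charlier a n.
Proof.
rewrite !charlierE poly_shift_sum -sumrB big_ord_recl /= poly_shiftZ.
rewrite binomial_poly0 poly_shiftC subrr add0r; apply: eq_bigr => i _.
by rewrite poly_shiftZ -scalerBr binomial_poly_diff.
Qed.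

(** In the binomial basis, [f |-> 'X * f(x - 1)] sends the [j]-th element to
    [j.+1] times the next one, so the [j]-th coefficient [u j] of [charlier a
    n.+1] is counted [j] times by the first summand and [n.+1 - j] times by the
    second. *)
Lemma charlier_raising a n :
  n.+1%:R *: charlier a n.+1 = 'X * poly_shift (-1) (charlier a n) - a *: charlier a n.
Proof.
pose u (j : nat) := (- a) ^+ (n.+1 - j) / (n.+1 - j)`!%:R.
have -> : 'X * poly_shift (-1) (charlier a n) =
    \sum_(j < n.+2) (j%:R * u j) *: binomial_poly R j.
  rewrite big_ord_recl /= mul0r scale0r add0r charlierE poly_shift_sum mulr_sumr.
  apply: eq_bigr => j _; rewrite poly_shiftZ -scalerAr -binomial_polyS scalerA.
  by rewrite mulrC /u subSS.
have -> : a *: charlier a n =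
    - \sum_(j < n.+2) ((n.+1 - j)%:R * u j) *: binomial_poly R j.
  rewrite big_ord_recr /= subnn mul0r scale0r addr0 charlierE scaler_sumr -sumrN.
  apply: eq_bigr => -[j /=]; rewrite ltnS => jn _; rewrite scalerA -scaleNr.
  congr (_ *: _); rewrite /u subSn// exprS factS natrM.
  have nz i : (i`!%:R : R) != 0 by rewrite pnatr_eq0 -lt0n fact_gt0.
  have nS : ((n - j).+1%:R : R) != 0 by rewrite pnatr_eq0.
  by field; rewrite nz addrC natr1 nS.
rewrite opprK -big_split /= charlierE scaler_sumr; apply: eq_bigr => j _.
rewrite scalerA -scalerDl -mulrDl -natrD subnKC//.
by rewrite -ltnS.
Qed.

Lemma size_charlier a n : size (charlier a n) = n.+1.
Proof.
rewrite charlierE big_ord_recr /= subnn expr0 fact0 divr1 scale1r.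
rewrite addrC size_polyDl ?size_binomial_poly// ltnS.
apply: (leq_trans (size_sum _ _ _)); apply/bigmax_leqP => j _.
by rewrite (leq_trans (size_scale_leq _ _))// size_binomial_poly.
Qed.

Lemma charlier_at0 a n : (charlier a n).[0] = (- a) ^+ n / n`!%:R.
Proof.
rewrite charlierE big_ord_recl /= hornerD horner_sum big1 ?addr0.
  by rewrite binomial_poly0 hornerZ hornerC mulr1 subn0.
move=> j _; rewrite hornerZ /binomial_poly -/(falling _) fallingS.
by rewrite hornerZ hornerM hornerX mul0r !mulr0.
Qed.

(** The second order difference operator of the Charlier polynomials, for
    polynomials translated by [e], with a constant subtracted so that its
    eigenvalues are the negative integers. *)
Definition charlier_op a (e : nat) p : {poly R} :=
  ('X - (e%:R)%:P) * poly_shift (-1) p - ('X - (e%:R)%:P + (a + 1)%:P) * p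
   + a *: poly_shift 1 p.

(** Substituting [charlier a n = charlier a n.+1 (x + 1) - charlier a n.+1] in
    the raising relation gives the case [e = 0]; the rest is a translation. *)
Lemma charlier_op_eigen a e n (P := poly_shift (- e%:Z) (charlier a n)) :
  charlier_op a e P = - n.+1%:R *: P.
Proof.
have base : 'X * poly_shift (-1) (charlier a n) - ('X + (a + 1)%:P) * charlier a n
    + a *: poly_shift 1 (charlier a n) = - n.+1%:R *: charlier a n.
  case: n @P => [_|n _].
    by rewrite charlier0 !poly_shiftC -!mul_polyC !(polyCN, polyCD, polyC1); ring.
  have := charlier_raising a n; rewrite -(charlier_diff a n).
  rewrite poly_shiftB poly_shiftNK -!mul_polyC !polyCN => raising.
  have -> : (n.+2%:R : R) = n.+1%:R + 1 by rewrite natr1.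
  by rewrite !polyCD mulNr [in RHS]mulrDl raising polyC1; ring.
have : poly_shift (- e%:Z) ('X * poly_shift (-1) (charlier a n)
    - ('X + (a + 1)%:P) * charlier a n + a *: poly_shift 1 (charlier a n)) =
  - n.+1%:R *: P by rewrite base poly_shiftZ.
rewrite poly_shiftD poly_shiftB !poly_shiftM poly_shiftZ poly_shiftD poly_shiftX poly_shiftC.
rewrite !poly_shift_shift => <-; rewrite /charlier_op /P !poly_shift_shift.
by rewrite mulrNz polyCN ![(_ + - e%:Z)%R]addrC ![(- e%:Z + _)%R]addrC addrAC.
Qed.

End CharlierPolynomials.

(** * Orthogonality and moments of Charlier polynomials *)

Section Moments.
Variable R : realType.
Implicit Types (a : R) (p q f g w : {poly R}).

Lemma charlier_measure_integral (F : seq nat) a p :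
  sintegrable (pF_charlier_measure F a) (fun x => p.[x]) /\
  Defs.sintegral (pF_charlier_measure F a) (fun x => p.[x]) =
    charlier_fun a (pF R F * p).
Proof.
have eq_w : (fun x : nat => (pF R F).[x%:R] * (a ^+ x / x`!%:R) * p.[x%:R]) =
    (fun x => (pF R F * p).[x%:R] * (a ^+ x / x`!%:R)).
  by apply/funext => x; rewrite hornerM mulrAC.
have cp : cvgn [normed series
    (fun x : nat => (pF R F).[x%:R] * (a ^+ x / x`!%:R) * p.[x%:R])].
  by rewrite eq_w; exact: is_cvg_charlier.
have [|ip ->] := signed_atomic_integral _ cp; last by rewrite eq_w.
by apply: continuous_measurable_fun; exact: continuous_horner.
Qed.

Lemma charlier_funN a p : charlier_fun a (- p) = - charlier_fun a p.
Proof. by rewrite -scaleN1r charlier_funZ mulN1r. Qed.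

Lemma charlier_funB a p q :
  charlier_fun a (p - q) = charlier_fun a p - charlier_fun a q.
Proof. by rewrite charlier_funD charlier_funN. Qed.

(** Summation by parts: the raising relation moves a difference from the
    Charlier polynomial to the other factor. *)
Lemma charlier_fun_parts a n g :
  n.+1%:R * charlier_fun a (charlier a n.+1 * g) =
  a * charlier_fun a (charlier a n * (poly_shift 1 g - g)).
Proof.
rewrite -charlier_funZ scalerAl charlier_raising mulrBl -mulrA charlier_funB.
rewrite charlier_funXM poly_shiftM poly_shiftK -(scalerAl a) charlier_funZ -mulrBr.
by rewrite -charlier_funB -mulrBr.
Qed.

(** By [n] summations by parts, as each difference lowers the degree. *)
Lemma charlier_fun_orth a n g : (size g <= n)%N ->
  charlier_fun a (charlier a n * g) = 0.
Proof.
elim: n g => [|n IH] g sg.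
  have -> : g = 0 by apply/eqP; rewrite -size_poly_leq0.
  by rewrite mulr0 -(scale0r 0) charlier_funZ mul0r.
have nz : (n.+1%:R : R) != 0 by rewrite pnatr_eq0.
apply: (mulfI nz); rewrite charlier_fun_parts IH ?mulr0//.
by rewrite (leq_trans (size_poly_diff _))//; case: (size g) sg.
Qed.

(** The squared norms [a ^+ n / n`! * expR a], by summation by parts. *)
Lemma charlier_fun_norm_neq0 a n : a != 0 ->
  charlier_fun a (charlier a n * charlier a n) != 0.
Proof.
move=> a0; elim: n => [|n IH].
  by rewrite charlier0 mulr1 charlier_fun1 gt_eqF// expR_gt0.
have nz : (n.+1%:R : R) != 0 by rewrite pnatr_eq0.
by rewrite -(mulrI_eq0 _ (mulfI nz)) charlier_fun_parts charlier_diff mulf_neq0.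
Qed.

Lemma charlier_fun_orth_neq0 a n g : a != 0 -> size g = n.+1 ->
  charlier_fun a (charlier a n * g) != 0.
Proof.
move=> a0 sg.
have c0 : charlier a n != 0 by rewrite -size_poly_eq0 size_charlier.
have g0 : g != 0 by rewrite -size_poly_eq0 sg.
have := size_sub_lead c0 (etrans sg (esym (size_charlier a n))).
set r := lead_coef g / _; rewrite size_charlier ltnS => sr.
rewrite -(subrK (r *: charlier a n) g) mulrDr charlier_funD charlier_fun_orth//.
rewrite add0r -scalerAr charlier_funZ mulf_neq0 ?charlier_fun_norm_neq0//.
by rewrite mulf_neq0 ?invr_eq0 ?lead_coef_eq0.
Qed.

(** Iteration of the Pearson equation. *)
Lemma charlier_fun_falling a k g :
  charlier_fun a (falling R k * g) = a ^+ k * charlier_fun a (poly_shift k%:Z g).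
Proof.
elim: k g => [|k IH] g; first by rewrite /falling big_ord0 !mul1r poly_shift0.
rewrite fallingS -mulrA charlier_funXM poly_shiftM poly_shiftK IH.
by rewrite poly_shift_shift exprS mulrA (_ : k%:Z + 1 = k.+1)//; lia.
Qed.

Lemma pF_iota k : pF R (iota 1 k) = poly_shift (-1) (falling R k).
Proof.
have XpF : 'X * pF R (iota 1 k) = falling R k.+1.
  rewrite /falling /pF big_ord_recl/= subr0; congr (_ * _).
  by rewrite -{1}(addn0 1%N) iotaDl big_map -[k]subn0 big_mkord subn0.
apply: (@mulfI _ 'X); first by rewrite polyX_eq0.
by rewrite XpF fallingS.
Qed.

(** Multiplication by ['X] completes [pF] to a falling factorial, hence turns
    the modified measure into a translate of the Charlier measure. *)
Lemma X_pF_iota k : 'X * pF R (iota 1 k) = falling R k.+1.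
Proof. by rewrite pF_iota fallingS. Qed.

(** The difference relation of the falling factorials, translated by [-1]. *)
Lemma pF_iotaS k :
  pF R (iota 1 k.+1) + k.+1%:R *: pF R (iota 1 k) = falling R k.+1.
Proof.
have := congr1 (poly_shift (-1)) (falling_diff R k).
by rewrite poly_shiftB poly_shiftNK poly_shiftZ -!pF_iota => <-; rewrite addrC subrK.
Qed.

Lemma charlier_shift_sum a n l :
  poly_shift (l - 1) (charlier a n.+1) + poly_shift (l - 1) (charlier a n) =
  poly_shift l (charlier a n.+1).
Proof.
by rewrite -{1}(charlier_diff a n) poly_shiftB addrC subrK poly_shift_shift subrK.
Qed.

Lemma charlier_fun_shift_charlier a n :
  charlier_fun a (poly_shift (-1) (charlier a n)) = (-1) ^+ n * expR a.
Proof.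
elim: n => [|n IH]; first by rewrite charlier0 poly_shiftC charlier_fun1 mul1r.
have := charlier_fun_orth a (n := n.+1) (g := 1) _; rewrite size_poly1 mulr1 => /(_ isT).
rewrite -{1}[charlier a n.+1]poly_shift0 -(charlier_shift_sum a n 0) sub0r charlier_funD.
by rewrite IH => /eqP; rewrite addr_eq0 => /eqP ->; rewrite exprS mulN1r mulNr.
Qed.

(** The moment of a translated Charlier polynomial against the modified weight
    is, up to a constant and a sign, a Charlier polynomial of parameter [- a]
    in the dual variable [n]. Let [I k n] be the left-hand side. Expanding [pF] by
    [pF_iotaS] and the Charlier polynomial by [charlier_shift_sum] gives
    [I k.+1 n.+1 + I k.+1 n + k.+1 * I k n.+1 = 0], because the remaining term
    is a multiple of the integral of [charlier a n.+1]. The right-hand side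
    satisfies the same recurrence, which for it is [charlier_diff], and the
    initial values at [n = 0] agree. *)
Lemma charlier_fun_dual a k n :
  charlier_fun a (pF R (iota 1 k) * poly_shift (- k.+1%:Z) (charlier a n)) =
  expR a * k`!%:R * (-1) ^+ n * (charlier (- a) k).[- n.+1%:R].
Proof.
have c_recE k' x : (charlier (- a) k'.+1).[x] =
    (charlier (- a) k'.+1).[x + 1] - (charlier (- a) k').[x].
  by rewrite -(charlier_diff _ k') hornerD hornerN horner_poly_shift opprB addrC subrK.
elim: k n => [|k IHk] n.
  rewrite /pF big_nil mul1r charlier_fun_shift_charlier charlier0 hornerC mulr1.
  by rewrite fact0 mulr1 mulrC.
(* One step in [k] alone, whose inhomogeneous term alternates in [m]. *)
have rec m : charlier_fun a (pF R (iota 1 k.+1) * poly_shift (- k.+2%:Z) (charlier a m))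
    = a ^+ k.+1 * ((-1) ^+ m * expR a) - k.+1%:R * charlier_fun a
      (pF R (iota 1 k) * poly_shift (- k.+2%:Z) (charlier a m)).
  apply/eqP; rewrite -subr_eq opprK -charlier_funZ -charlier_funD scalerAl -mulrDl.
  rewrite pF_iotaS charlier_fun_falling poly_shift_shift -charlier_fun_shift_charlier.
  by rewrite (_ : k.+1%:Z - k.+2%:Z = -1)//; lia.
elim: n => [|n IHn].
  have := rec 0%N; rewrite charlier0 !poly_shiftC mulr1.
  have := IHk 0%N; rewrite charlier0 !poly_shiftC => -> ->.
  rewrite (c_recE k) [- 1%:R + 1]addNr charlier_at0 factS natrM opprK.
  have nz i : (i`!%:R : R) != 0 by rewrite pnatr_eq0 -lt0n fact_gt0.
  have kz : (k.+1%:R : R) != 0 by rewrite pnatr_eq0.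
  by field; rewrite nz addrC natr1 kz.
have := IHk n.+1.
rewrite (_ : - k.+1%:Z = - k.+2%:Z + 1 :> int); last by lia.
rewrite -(charlier_shift_sum a n) addrK mulrDr charlier_funD => sumE.
have := rec n; rewrite IHn => recn.
rewrite (rec n.+1).
move: recn sumE; set u := charlier_fun a (_ * poly_shift _ (charlier a n)).
set v := charlier_fun a (_ * poly_shift _ (charlier a n.+1)) => recn sumE.
rewrite -(addrK u v) sumE mulrBr (c_recE k (- n.+2%:R)).
rewrite (_ : - n.+2%:R + 1 = - n.+1%:R :> R); last by rewrite -[n.+2%:R]natr1; ring.
have -> : k.+1%:R * u = a ^+ k.+1 * ((-1) ^+ n * expR a) -
    expR a * (k.+1)`!%:R * (-1) ^+ n * (charlier (- a) k.+1).[- n.+1%:R].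
  by rewrite recn opprB addrC subrK.
by rewrite !exprS factS natrM; ring.
Qed.

Lemma charlier_fun_combM a x y p q g :
  charlier_fun a ((x *: p + y *: q) * g) =
  x * charlier_fun a (p * g) + y * charlier_fun a (q * g).
Proof. by rewrite mulrDl -!scalerAl charlier_funD !charlier_funZ. Qed.

Lemma charlier_fun_expand a w f g :
  charlier_fun a (w * (f * g)) =
  \sum_(i < size g) g`_i * charlier_fun a (w * (f * 'X^i)).
Proof.
have fun_sum n (F : 'I_n -> {poly R}) :
    charlier_fun a (\sum_(i < n) F i) = \sum_(i < n) charlier_fun a (F i).
  elim: n F => [|n IH] F.
    by rewrite !big_ord0 -(scale0r 0) charlier_funZ mul0r.
  by rewrite !big_ord_recl charlier_funD IH.
rewrite -{1}[g]coefK poly_def !mulr_sumr fun_sum; apply: eq_bigr => i _.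
by rewrite -!scalerAr charlier_funZ.
Qed.

(** Uniqueness of orthogonal polynomials up to a factor. The difference [r]
    of the two candidates has degree [m < n] and is orthogonal to all degrees
    below [n], so its pairing with [q m] vanishes; computed the other way
    round, that pairing is the leading coefficient of [r] times the nonzero
    pairing of [q m] with ['X^m]. *)
Lemma orthogonal_unique a w (q : nat -> {poly R}) (n : nat) (Q : {poly R}) :
    (forall n, size (q n) = n.+1) ->
    (forall n m, (m < n)%N -> charlier_fun a (w * (q n * 'X^m)) = 0) ->
    (forall n, charlier_fun a (w * (q n * 'X^n)) <> 0) ->
    size Q = n.+1 ->
    (forall m, (m < n)%N -> charlier_fun a (w * (Q * 'X^m)) = 0) ->
  q n = (lead_coef (q n) / lead_coef Q) *: Q.
Proof.
move=> sq q0 qn sQ Q0; set c := _ / _; apply/eqP; rewrite -subr_eq0.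
have Q_neq0 : Q != 0 by rewrite -size_poly_eq0 sQ.
have := size_sub_lead Q_neq0 (etrans (sq n) (esym sQ)); rewrite -/c sQ ltnS.
set r := _ - _ => sr; apply/negPn/negP => r0.
have r_orth m : (m < n)%N -> charlier_fun a (w * (r * 'X^m)) = 0.
  move=> mn; rewrite /r mulrBl -scalerAl mulrBr -scalerAr charlier_funB.
  by rewrite charlier_funZ q0// Q0// mulr0 subrr.
have r_gt0 : (0 < size r)%N by rewrite size_poly_gt0.
have sm : size r = (size r).-1.+1 by rewrite prednK.
set m := (size r).-1 in sm; have mn : (m < n)%N by rewrite -sm.
have : charlier_fun a (w * (q m * r)) = 0.
  rewrite [q m * r]mulrC charlier_fun_expand big1// => i _.
  by rewrite r_orth ?mulr0//; have := leq_trans (ltn_ord i) (eq_leq (sq m)); lia.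
rewrite charlier_fun_expand sm big_ord_recr /= big1 ?add0r => [|i _]; last first.
  by rewrite q0 ?mulr0.
move/eqP; rewrite mulf_eq0 => /orP[|/eqP]; last exact: qn.
by rewrite -[m]/(m.+1.-1) -sm -lead_coefE lead_coef_eq0 (negbTE r0).
Qed.

End Moments.

(** * Coefficients of polynomials in the Charlier operator *)

Section Operators.
Variable R : realType.
Implicit Types (a : R) (p q : {poly R}) (T : {poly R} -> {poly R}).
Implicit Types (f g : int -> {poly R}).

Lemma charlier_op_is_linear a e : linear (charlier_op a e).
Proof.
move=> c p q; rewrite /charlier_op !poly_shiftD !poly_shiftZ -!mul_polyC; ring.
Qed.

HB.instance Definition _ a e :=
  GRing.isLinear.Build R {poly R} {poly R} _ (charlier_op a e)
    (charlier_op_is_linear a e).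

Definition op_poly T (u : {poly R}) p : {poly R} :=
  \sum_(i < size u) u`_i *: iter i T p.

Lemma op_poly_is_linear (T : {linear {poly R} -> {poly R}}) u :
  linear (op_poly T u).
Proof.
have iter_lin i c p q : iter i T (c *: p + q) = c *: iter i T p + iter i T q.
  by elim: i => //= i ->; rewrite linearP.
move=> c p q; rewrite /op_poly scaler_sumr -big_split; apply: eq_bigr => i _ /=.
by rewrite iter_lin scalerDr !scalerA mulrC.
Qed.

HB.instance Definition _ (T : {linear {poly R} -> {poly R}}) u :=
  GRing.isLinear.Build R {poly R} {poly R} _ (op_poly T u)
    (op_poly_is_linear T u).

Lemma op_poly_eigen (T : {linear {poly R} -> {poly R}}) u mu p :
  T p = mu *: p -> op_poly T u p = u.[mu] *: p.
Proof.
move=> Tp; have iterT i : iter i T p = mu ^+ i *: p.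
  by elim: i => [|i IH]; rewrite ?scale1r//= IH linearZ/= Tp scalerA exprSr.
rewrite /op_poly horner_coef scaler_suml; apply: eq_bigr => i _.
by rewrite iterT scalerA.
Qed.

(** [T] is the difference operator with coefficients [f], which vanish outside
    the interval from [- m] to [m]. The sum runs over the larger window from
    [- M] to [M] so that operators of different genres can be added and
    composed inside one fixed window. *)
Definition shift_expansion (M m : nat) T f :=
  (forall l : int, (m < `|l|)%N -> f l = 0) /\
  forall p, T p = \sum_(0 <= i < (M + M).+1)
    f (- M%:Z + i%:Z) * poly_shift (- M%:Z + i%:Z) p.

Lemma shift_expansion_mono M m m' T f :
  (m <= m')%N -> shift_expansion M m T f -> shift_expansion M m' T f.
Proof.
move=> mm' [f0 Tf]; split => // l l_gt; apply: f0; exact: leq_ltn_trans l_gt.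
Qed.

Lemma shift_expansionD M m T f T' f' :
  shift_expansion M m T f -> shift_expansion M m T' f' ->
  shift_expansion M m (fun p => T p + T' p) (fun l => f l + f' l).
Proof.
move=> [f0 Tf] [f0' Tf']; split => [l l_gt|p]; first by rewrite f0 ?f0' ?addr0.
by rewrite Tf Tf' -big_split; apply: eq_bigr => i _; rewrite mulrDl.
Qed.

Lemma shift_expansionM M m T f c : shift_expansion M m T f ->
  shift_expansion M m (fun p => c * T p) (fun l => c * f l).
Proof.
move=> [f0 Tf]; split => [l l_gt|p]; first by rewrite f0 ?mulr0.
by rewrite Tf mulr_sumr; apply: eq_bigr => i _; rewrite mulrA.
Qed.

Lemma sum_nat_slide n (F G : nat -> {poly R}) :
  F n = 0 -> G 0%N = 0 -> (forall i, G i.+1 = F i) ->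
  \sum_(0 <= i < n.+1) F i = \sum_(0 <= i < n.+1) G i.
Proof.
move=> Fn G0 FG; rewrite big_nat_recr//= [RHS]big_nat_recl//= Fn G0 addr0 add0r.
by apply: eq_bigr => i _; rewrite FG.
Qed.

Lemma shift_expansion_up M m T f : (m < M)%N -> shift_expansion M m T f ->
  shift_expansion M m.+1 (fun p => poly_shift 1 (T p))
    (fun l => poly_shift 1 (f (l - 1))).
Proof.
move=> mM [f0 Tf]; have s0 : poly_shift 1 (0 : {poly R}) = 0
  by rewrite /poly_shift linear0.
split => [l l_gt|p]; first by rewrite f0 ?s0//; lia.
rewrite Tf big_mkord poly_shift_sum -(big_mkord xpredT (fun i : nat => poly_shift 1
  (f (- M%:Z + i%:Z) * poly_shift (- M%:Z + i%:Z) p))).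
apply: sum_nat_slide => [||i].
- by rewrite f0 ?mul0r//; lia.
- by rewrite f0 ?s0 ?mul0r//; lia.
- rewrite poly_shiftM poly_shift_shift.
  have -> : - M%:Z + i.+1%:Z - 1 = - M%:Z + i%:Z by lia.
  by have -> : - M%:Z + i.+1%:Z = 1 + (- M%:Z + i%:Z) by lia.
Qed.

Lemma shift_expansion_down M m T f : (m < M)%N -> shift_expansion M m T f ->
  shift_expansion M m.+1 (fun p => poly_shift (-1) (T p))
    (fun l => poly_shift (-1) (f (l + 1))).
Proof.
move=> mM [f0 Tf]; have s0 : poly_shift (-1) (0 : {poly R}) = 0
  by rewrite /poly_shift linear0.
split => [l l_gt|p]; first by rewrite f0 ?s0//; lia.
rewrite Tf big_mkord poly_shift_sum -(big_mkord xpredT (fun i : nat => poly_shift (-1)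
  (f (- M%:Z + i%:Z) * poly_shift (- M%:Z + i%:Z) p))).
apply/esym; apply: sum_nat_slide => [||i].
- by rewrite f0 ?s0 ?mul0r//; lia.
- by rewrite f0 ?mul0r//; lia.
- rewrite poly_shiftM poly_shift_shift.
  have -> : - M%:Z + i.+1%:Z = - M%:Z + i%:Z + 1 by lia.
  by have -> : -1 + (- M%:Z + i%:Z + 1) = - M%:Z + i%:Z by lia.
Qed.

(** The effect on the coefficients of an operator of following it by
    [charlier_op a e]. *)
Definition charlier_op_coef a (e : nat) f (l : int) : {poly R} :=
  ('X - (e%:R)%:P) * poly_shift (-1) (f (l + 1)) +
  (- ('X - (e%:R)%:P + (a + 1)%:P)) * f l + a%:P * poly_shift 1 (f (l - 1)).

Lemma shift_expansion_charlier_op M m a e T f :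
  (m < M)%N -> shift_expansion M m T f ->
  shift_expansion M m.+1 (fun p => charlier_op a e (T p)) (charlier_op_coef a e f).
Proof.
move=> mM Tf.
rewrite (_ : (fun p => _) = (fun p => ('X - (e%:R)%:P) * poly_shift (-1) (T p) +
  (- ('X - (e%:R)%:P + (a + 1)%:P)) * T p + a%:P * poly_shift 1 (T p))); last first.
  by apply/funext => p; rewrite /charlier_op mulNr mul_polyC.
apply: shift_expansionD; last exact/shift_expansionM/shift_expansion_up.
by apply: shift_expansionD; apply: shift_expansionM; 
  [exact: shift_expansion_down|exact: shift_expansion_mono Tf].
Qed.

Definition iter_coef a e i : int -> {poly R} :=
  iter i (charlier_op_coef a e) (fun l => (l == 0)%:R).

Lemma shift_expansion_iter M a e i : (i <= M)%N ->
  shift_expansion M i (iter i (charlier_op a e)) (iter_coef a e i).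
Proof.
elim: i => [_|i IH iM]; last first.
  by apply: shift_expansion_charlier_op => //; exact/IH/ltnW.
split => [l l_gt|p]; first by rewrite /iter_coef /=; case: eqP l_gt => // ->.
(* The shift by zero sits at position [M] of the window. *)
rewrite /= /iter_coef /= big_mkord (bigD1 (inord M : 'I_(M + M).+1))//=.
rewrite inordK ?ltnS ?leq_addr// addNr eqxx mul1r poly_shift0 big1 ?addr0//.
move=> i; rewrite -val_eqE/= inordK ?ltnS ?leq_addr// => iM.
by rewrite (_ : (- M%:Z + i%:Z == 0) = false) ?mul0r//; lia.
Qed.

Lemma iter_coef_gt a e i l : (i < `|l|)%N -> iter_coef a e i l = 0.
Proof. by case: (shift_expansion_iter a e (leqnn i)) => h _; exact: h. Qed.

(** Each application of [charlier_op] multiplies the uppermost coefficient by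
    [a], and a translate of the lowermost one by a polynomial of degree one;
    nothing else contributes to the two ends. *)
Lemma iter_coef_top a e i : iter_coef a e i i%:Z = (a ^+ i)%:P.
Proof.
elim: i => [|i IH]; first by rewrite expr0 polyC1.
rewrite /iter_coef /= -/(iter_coef a e i) /charlier_op_coef.
rewrite [iter_coef a e i (_ + 1)]iter_coef_gt; last by lia.
rewrite [iter_coef a e i i.+1%:Z]iter_coef_gt; last by lia.
rewrite (_ : i.+1%:Z - 1 = i) ?IH; last by lia.
by rewrite /poly_shift linear0 comp_polyC !mulr0 !add0r -polyCM -exprS.
Qed.

Lemma size_iter_coef_bottom a e i : size (iter_coef a e i (- i%:Z)) = i.+1.
Proof.
elim: i => [|i IH]; first by rewrite oppr0 /iter_coef size_poly1.
rewrite /iter_coef /= -/(iter_coef a e i) /charlier_op_coef.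
rewrite [iter_coef a e i (- i.+1%:Z)]iter_coef_gt; last by lia.
rewrite [iter_coef a e i (_ - 1)]iter_coef_gt; last by lia.
rewrite (_ : - i.+1%:Z + 1 = - i%:Z); last by lia.
rewrite /poly_shift linear0 !mulr0 !addr0 -/(poly_shift (-1) _).
by rewrite size_monicM ?monicXsubC -?size_poly_gt0 ?size_poly_shift ?IH// size_XsubC.
Qed.

Definition op_poly_coef a e (u : {poly R}) (l : int) : {poly R} :=
  \sum_(i < size u) u`_i *: iter_coef a e i l.

Lemma shift_expansion_op_poly M m a e (u : {poly R}) : (m <= M)%N -> (size u <= m.+1)%N ->
  shift_expansion M m (op_poly (charlier_op a e) u) (op_poly_coef a e u).
Proof.
move=> mM su; split => [l l_gt|p].
  rewrite /op_poly_coef big1// => i _; rewrite iter_coef_gt ?scaler0//.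
  by have := ltn_ord i; lia.
rewrite /op_poly /op_poly_coef.
have -> : \sum_(i < size u) u`_i *: iter i (charlier_op a e) p =
    \sum_(i < size u) \sum_(0 <= j < (M + M).+1) (u`_i *: iter_coef a e i (- M%:Z + j%:Z))
      * poly_shift (- M%:Z + j%:Z) p.
  apply: eq_bigr => i _; have iM : (i <= M)%N by have := ltn_ord i; lia.
  have [_ ->] := shift_expansion_iter a e iM.
  by rewrite scaler_sumr; apply: eq_bigr => j _; rewrite scalerAl.
by rewrite exchange_big; apply: eq_bigr => j _; rewrite -mulr_suml.
Qed.

(** Only the highest power of the operator reaches the ends of the window. *)
Lemma op_poly_coef_top a e (u : {poly R}) m : size u = m.+1 ->
  op_poly_coef a e u m%:Z = (lead_coef u * a ^+ m)%:P.
Proof.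
move=> su; rewrite /op_poly_coef su big_ord_recr/= iter_coef_top big1 ?add0r.
  by rewrite lead_coefE su -mul_polyC -polyCM.
by move=> i _; rewrite iter_coef_gt ?scaler0.
Qed.

Lemma size_op_poly_coef_bottom a e (u : {poly R}) m : size u = m.+1 ->
  size (op_poly_coef a e u (- m%:Z)) = m.+1.
Proof.
move=> su; rewrite /op_poly_coef su big_ord_recr/= big1 ?add0r.
  have um : u`_m != 0.
    by rewrite -[m]/(m.+1.-1) -su -lead_coefE lead_coef_eq0 -size_poly_eq0 su.
  by rewrite size_scale// size_iter_coef_bottom.
by move=> i _; rewrite iter_coef_gt ?scaler0//; have := ltn_ord i; lia.
Qed.

End Operators.

(** * The orthogonal polynomials and their difference operator *)

Section KrallCharlier.
Variables (R : realType) (k : nat) (a : R).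
Implicit Types (p g : {poly R}).

Local Notation w := (pF R (iota 1 k)).
Local Notation L := (charlier_op a k.+1).
Local Notation d := (charlier (- a)).

Definition shifted_charlier n : {poly R} := poly_shift (- k.+1%:Z) (charlier a n).
Local Notation P := shifted_charlier.
Local Notation P_prev n := (poly_shift 1 (P n) - P n).

(** Here [P_prev n] is [P n.-1], and [0] for [n = 0]. The coefficients are the
    ones for which the integrals of the two summands, given by
    [charlier_fun_dual], cancel. *)
Definition krall_charlier n : {poly R} :=
  (d k).[- n%:R] *: P n + (d k).[- n.+1%:R] *: P_prev n.

Definition krall_charlier_op p : {poly R} :=
  poly_shift (-1) (op_poly L (d k) p) + op_poly L (d k.+1) p.

Lemma krall_charlier_opZ c p : krall_charlier_op (c *: p) = c *: krall_charlier_op p.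
Proof. by rewrite /krall_charlier_op !linearZ/= poly_shiftZ scalerDr. Qed.

Lemma P_prevS n : P_prev n.+1 = P n.
Proof.
rewrite /P -(charlier_diff a n) poly_shiftB !poly_shift_shift.
by rewrite [1 + _]addrC.
Qed.

Lemma P_prev0 : P_prev 0 = 0.
Proof. by rewrite /P charlier0 !poly_shiftC subrr. Qed.

Lemma charlier_op_P n : L (P n) = - n.+1%:R *: P n.
Proof. exact: charlier_op_eigen. Qed.

Lemma charlier_op_P_prev n : L (P_prev n) = - n%:R *: P_prev n.
Proof.
by case: n => [|n]; rewrite ?P_prev0 ?linear0 ?scaler0// P_prevS charlier_op_P.
Qed.

(** On [P n] and [P_prev n], which are eigenvectors of [L] for [- n.+1] and
    [- n], [d k] in [L] evaluates [d k] at these points. So it maps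
    [krall_charlier n] to a multiple of [P n + P_prev n], the forward shift of
    [P n], which the backward shift takes to [P n]. It remains to see that
    this extra multiple of [P n] makes up for the difference between the two
    eigenvalues of [d k.+1] in [L], which is the relation [charlier_diff]. *)
Lemma krall_charlier_eigen n :
  krall_charlier_op (krall_charlier n) = (d k.+1).[- n%:R] *: krall_charlier n.
Proof.
have opP u : op_poly L u (krall_charlier n) =
    ((d k).[- n%:R] * u.[- n.+1%:R]) *: P n +
    ((d k).[- n.+1%:R] * u.[- n%:R]) *: P_prev n.
  rewrite /krall_charlier linearD !linearZ/=.
  rewrite (op_poly_eigen u (charlier_op_P n)) (op_poly_eigen u (charlier_op_P_prev n)).
  by rewrite !scalerA.
rewrite /krall_charlier_op !opP [(d k).[- n.+1%:R] * _]mulrC -scalerDr.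
rewrite [P n + _]addrC subrK poly_shiftZ poly_shiftNK /krall_charlier.
have dE : (d k).[- n.+1%:R] = (d k.+1).[- n%:R] - (d k.+1).[- n.+1%:R].
  rewrite -[in LHS](charlier_diff _ k) hornerD hornerN horner_poly_shift.
  by rewrite -{1}[n.+1%:R]natr1 opprD addrNK.
have -> : (d k.+1).[- n.+1%:R] = (d k.+1).[- n%:R] - (d k).[- n.+1%:R].
  by rewrite dE; ring.
rewrite -!mul_polyC !(polyCM, polyCB); ring.
Qed.

Hypothesis a_neq0 : a != 0.
Hypothesis ck_neq0 : forall n : nat, (1 <= n)%N -> (d k).[- n%:R] != 0.

(** At [n = 0] the value is [a ^+ k / k`!]. *)
Lemma dk_neq0 n : (d k).[- n%:R] != 0.
Proof.
case: n => [|n]; last exact: ck_neq0.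
by rewrite oppr0 charlier_at0 opprK mulf_neq0 ?expf_neq0//.
Qed.

Lemma size_P n : size (P n) = n.+1.
Proof. by rewrite size_poly_shift size_charlier. Qed.

Lemma size_krall_charlier n : size (krall_charlier n) = n.+1.
Proof.
rewrite /krall_charlier size_polyDl ?size_scale ?dk_neq0 ?size_P// ltnS.
by rewrite (leq_trans (size_poly_diff _))// size_P.
Qed.

Lemma krall_charlier_integralX n g :
  charlier_fun a (w * (krall_charlier n * ('X * g))) =
  a ^+ k.+1 * charlier_fun a (((d k).[- n%:R] *: charlier a n +
    (d k).[- n.+1%:R] *: (poly_shift 1 (charlier a n) - charlier a n))
    * poly_shift k.+1%:Z g).
Proof.
rewrite (_ : w * _ = 'X * w * (krall_charlier n * g)); last by ring.
rewrite X_pF_iota charlier_fun_falling poly_shiftM.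
congr (_ * charlier_fun _ (_ * _)); rewrite /krall_charlier.
rewrite /shifted_charlier; move: (charlier a n) => c.
rewrite poly_shiftD !poly_shiftZ poly_shiftB !poly_shift_shift subrr poly_shift0.
by rewrite [k.+1%:Z + 1]addrC addrK.
Qed.

(** The factor [(-1) ^+ n] in [charlier_fun_dual] gives the two equal
    contributions opposite signs. *)
Lemma krall_charlier_integral0 n : charlier_fun a (w * krall_charlier n.+1) = 0.
Proof.
rewrite /krall_charlier P_prevS mulrC charlier_fun_combM ![_ * w]mulrC.
by rewrite !charlier_fun_dual exprS; ring.
Qed.

(** Against positive powers of ['X] the measure is a translated Charlier
    measure, for which both summands are orthogonal polynomials of degree at
    least [n.-1]. *)
Lemma krall_charlier_orth n m : (m < n)%N ->
  charlier_fun a (w * (krall_charlier n * 'X^m)) = 0.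
Proof.
case: n => // n; case: m => [_|m]; first by rewrite mulr1 krall_charlier_integral0.
rewrite ltnS => mn; rewrite exprS krall_charlier_integralX charlier_diff.
have sz : (size (poly_shift k.+1%:Z ('X^m : {poly R})) <= n)%N.
  by rewrite size_poly_shift size_polyXn.
rewrite charlier_fun_combM !charlier_fun_orth ?leqW//.
by rewrite !mulr0 addr0 mulr0.
Qed.

Lemma krall_charlier_orth_neq0 n :
  charlier_fun a (w * (krall_charlier n * 'X^n)) != 0.
Proof.
case: n => [|n].
  rewrite mulr1 /krall_charlier P_prev0 scaler0 addr0 -scalerAr charlier_funZ.
  rewrite charlier_fun_dual expr0 mulr1 !mulf_neq0 ?dk_neq0//; last by rewrite gt_eqF// expR_gt0.
rewrite exprS krall_charlier_integralX charlier_diff.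
have sz : size (poly_shift k.+1%:Z ('X^n : {poly R})) = n.+1.
  by rewrite size_poly_shift size_polyXn.
rewrite charlier_fun_combM charlier_fun_orth ?sz//.
rewrite mulr0 add0r !mulf_neq0 ?expf_neq0 ?dk_neq0//.
exact: charlier_fun_orth_neq0.
Qed.

(** At the upper end only [d k.+1] contributes. At the lower end
    the backward shift makes [d k] contribute as well, but with a coefficient
    of degree [k], while that of [d k.+1] has degree [k.+1]. *)
Lemma krall_charlier_op_genre :
  diffop_genre krall_charlier_op (- k.+1%:Z) k.+1%:Z.
Proof.
split; first by lia.
have sd n : size (d n) = n.+1 by exact: size_charlier.
have lt_k : (k < k.+1)%N by [].
have Uk := shift_expansion_op_poly a k.+1 (leqnSn k) (eq_leq (sd k)).
have Uk1 := shift_expansion_op_poly a k.+1 (leqnn k.+1) (eq_leq (sd k.+1)).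
have [_ opE] := shift_expansionD (shift_expansion_down lt_k Uk) Uk1.
exists (fun l => poly_shift (-1) (op_poly_coef a k.+1 (d k) (l + 1)) +
  op_poly_coef a k.+1 (d k.+1) l); split.
- rewrite -size_poly_eq0 addrC size_polyDl size_op_poly_coef_bottom//.
  rewrite size_poly_shift (_ : - k.+1%:Z + 1 = - k%:Z); last by lia.
  by rewrite size_op_poly_coef_bottom.
- have [Uk_vanish _] := Uk; rewrite Uk_vanish; last by lia.
  rewrite /poly_shift linear0 add0r op_poly_coef_top// polyC_eq0.
  by rewrite mulf_neq0 ?expf_neq0// lead_coef_eq0 -size_poly_eq0 sd.
- move=> p; rewrite /krall_charlier_op opE.
  by rewrite (_ : `|k.+1%:Z - - k.+1%:Z|%N = (k.+1 + k.+1)%N)//; lia.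
Qed.

End KrallCharlier.

Theorem corollary4p4 (R : realType) (k : nat) (a : R)
    (k_gt0 : (0 < k)%N) (a_neq0 : a != 0)
    (ck_neq0 : forall n : nat, (1 <= n)%N -> (charlier (- a) k).[- n%:R] != 0) :
  (exists q : nat -> {poly R},
     orthogonal_polynomials (pF_charlier_measure (iota 1 k) a) q) /\
  (forall q : nat -> {poly R},
     orthogonal_polynomials (pF_charlier_measure (iota 1 k) a) q ->
     exists (D : {poly R} -> {poly R}) (lambda : nat -> R),
       [/\ diffop_order D (2 * k + 2)%N,
           diffop_genre D (- (k.+1)%:Z) (k.+1)%:Z &
           forall n : nat, D (q n) = lambda n *: q n]).
Proof.
have integralE (p : {poly R}) m :
    Defs.sintegral (pF_charlier_measure (iota 1 k) a) (fun x => p.[x] * x ^+ m) =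
    charlier_fun a (pF R (iota 1 k) * (p * 'X^m)).
  have [_ <-] := charlier_measure_integral (iota 1 k) a (p * 'X^m).
  by congr Defs.sintegral; apply/funext => x; rewrite hornerM hornerXn.
split.
  exists (krall_charlier k a); split.
  - by move=> p; have [] := charlier_measure_integral (iota 1 k) a p.
  - by move=> n; rewrite size_krall_charlier.
  - by move=> n m mn; rewrite integralE krall_charlier_orth.
  - by move=> n; rewrite integralE; apply/eqP/krall_charlier_orth_neq0.
move=> q [_ sq q0 qn].
have genre := krall_charlier_op_genre k a_neq0.
exists (krall_charlier_op k a), (fun n => (charlier (- a) k.+1).[- n%:R]); split=> //.
  by exists (- k.+1%:Z), k.+1%:Z; split => //; lia.
move=> n; rewrite (orthogonal_unique (a := a) (w := pF R (iota 1 k)) (q := q)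
  (n := n) (Q := krall_charlier k a n)).
- by rewrite krall_charlier_opZ krall_charlier_eigen !scalerA mulrC.
- exact: sq.
- by move=> i j ij; rewrite -integralE q0.
- by move=> i; rewrite -integralE; exact: qn.
- exact: size_krall_charlier.
- by move=> m mn; exact: krall_charlier_orth.
Qed.
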